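(* Let $\beta$ be a quasi-Pisot or quasi-Salem number and $\eta$ an algebraic number with $D=[\mathbb{Q}(\beta,\eta):\mathbb{Q}(\beta)]$. Let $S$ be a finite subset of $\mathbb{Z}[\beta]$ with $0\in S$. Moreover, if $S\not\subset \mathbb{Z}$, then suppose that $\beta\notin\mathbb{R}$ and there exists an imaginary quadratic algebraic integer $\alpha\in \mathbb{Q}(\beta)$ such that $S$ is a finite subset of the ring of integers of $\mathbb{Q}(\alpha)$. Let $\mathbf{s}=(s_n)_{n\ge 0}$ be a sequence of elements of $S$ satisfying $\eta=\sum_{n=0}^{\infty}s_n\beta^{-n}$. Assume there exist $B_0\in \mathbb{Q}(\beta)$ and $B_1,\ldots,B_D\in \mathbb{Z}[\beta]$ with $B_D\neq 0$ satisfying $$\sum_{k=0}^{D}B_k\eta^k=0$$ and $$B_0\beta^n\notin \mathbb{Z}[\beta]\quad \text{for all } n\in \mathbb{N}.$$ Then there exist effectively computable positive numbers $C_{7}$ and $C_{8}$ such that $$\lambda(\mathbf{s};N):=\mathrm{Card}\{n\in \mathbb{Z}_{\geq 0}\mid n< N,\ s_n\neq 0\}\ge C_{7}\left(\frac{N}{\log N}\right)^{1/D}$$ for all integers $N\ge C_{8}$.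
   Context: $\mathbb{N}$ denotes the set of positive integers, $\mathbb{Z}_{\ge 0}$ the set of nonnegative integers, and $\mathrm{Card}$ denotes cardinality. Algebraic numbers are regarded as complex numbers via a fixed embedding $\overline{\mathbb{Q}}\hookrightarrow\mathbb{C}$. Quasi-Pisot and quasi-Salem numbers: let $\beta$ be an algebraic integer with $|\beta|>1$, and let $\beta_1=\beta,\beta_2,\ldots,\beta_d$ ($d=[\mathbb{Q}(\beta):\mathbb{Q}]$) be its conjugates over $\mathbb{Q}$. $\beta$ is a quasi-Pisot number if $|\beta_i|<1$ for every $\beta_i\notin\{\beta,\overline{\beta}\}$, where $\overline{\beta}$ is the complex conjugate of $\beta$. $\beta$ is a quasi-Salem number if $|\beta_i|\le 1$ for every $\beta_i\notin\{\beta,\overline{\beta}\}$ and there exists $1\le j\le d$ with $|\beta_j|=1$. *)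

(* Defs.v *)
From Stdlib Require List.
From mathcomp Require Import all_boot all_order all_algebra all_field.
From mathcomp Require Import all_classical all_reals all_analysis.
Set Implicit Arguments.
Unset Strict Implicit.
Unset Printing Implicit Defensive.
Import Order.TTheory GRing.Theory Num.Theory.
Import numFieldNormedType.Exports.
Local Open Scope ring_scope.

(* Algebraic numbers are elements of algC, the algebraic complex numbers, with
   the complex modulus as norm. *)

Definition conjugate (x y : algC) : bool := root (minCpoly x) y.

Definition quasi_Pisot (beta : algC) : Prop :=
  [/\ beta \in Aint, 1 < `|beta| &
      forall y, conjugate beta y -> y != beta -> y != beta^* -> `|y| < 1].

Definition quasi_Salem (beta : algC) : Prop :=
  [/\ beta \in Aint, 1 < `|beta|,
      forall y, conjugate beta y -> y != beta -> y != beta^* -> `|y| <= 1 &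
      exists2 y, conjugate beta y & `|y| = 1].

Definition in_Zadjoin (beta x : algC) : Prop :=
  exists p : {poly int}, x = (map_poly intr p).[beta].

Definition in_Qadjoin (beta x : algC) : Prop :=
  exists p q : {poly rat},
    (map_poly ratr q).[beta] != 0 /\
    x = (map_poly ratr p).[beta] / (map_poly ratr q).[beta].

(* [Q(beta, eta) : Q(beta)] = D, computed in a number field L embedded in algC;
   the value does not depend on L, and num_field_exists provides such an L. *)
Definition relative_degree (beta eta : algC) (D : nat) : Prop :=
  exists (L : fieldExtType rat) (phi : {rmorphism L -> algC}) (b e : L),
    [/\ phi b = beta, phi e = eta &
        \dim_<<1; b>>%VS <<<<1; b>>; e>>%VS = D].

Definition imaginary_quadratic (alpha : algC) : Prop :=
  size (minCpoly alpha) = 3%N /\ alpha \isn't Num.real.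

Definition in_integer_ring (alpha x : algC) : Prop :=
  in_Qadjoin alpha x /\ x \in Aint.

Definition lambda (s : nat -> algC) (N : nat) : nat :=
  #|[pred n : 'I_N | s n != 0]|.

(* Partial recursive functions, applied to lists of natural numbers; PrimRec and
   Mu recurse on, resp. search for, the first entry of the list. *)
Inductive recfun : Type :=
| Zero
| Succ
| Proj of nat
| Comp of recfun & seq recfun
| PrimRec of recfun & recfun
| Mu of recfun.

Inductive eval : recfun -> seq nat -> nat -> Prop :=
| eval_Zero v : eval Zero v 0
| eval_Succ v : eval Succ v (nth 0%N v 0).+1
| eval_Proj i v : eval (Proj i) v (nth 0%N v i)
| eval_Comp f gs v w y :
    evals gs v w -> eval f w y -> eval (Comp f gs) v y
| eval_PrimRec0 f g v y : eval f v y -> eval (PrimRec f g) (0%N :: v) y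
| eval_PrimRecS f g n v y z :
    eval (PrimRec f g) (n :: v) y -> eval g [:: n, y & v] z ->
    eval (PrimRec f g) (n.+1 :: v) z
| eval_Mu f v n (w : nat -> nat) :
    eval f (n :: v) 0 -> (forall m, (m < n)%N -> eval f (m :: v) (w m).+1) ->
    eval (Mu f) v n
with evals : seq recfun -> seq nat -> seq nat -> Prop :=
| evals_nil v : evals [::] v [::]
| evals_cons g gs v y w :
    eval g v y -> evals gs v w -> evals (g :: gs) v (y :: w).

(* The Goedel numbering is pickle. It is an explicit recursive coding on the
   types this is applied to, which are built from nat by sums, pairs, lists and
   decidable subtypes; on an arbitrary countType it need not be. *)
Definition computable (T U : countType) (f : T -> U) : Prop :=
  exists e : recfun, forall x : T, eval e [:: pickle x] (pickle (f x)).

(* An algebraic number is given by a nonzero integer polynomial vanishing at it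
   and a disc, with rational centre a + ib and radius r, isolating it from the
   other roots. *)
Definition algnum_code : countType := ({poly int} * (rat * rat * rat))%type.

Definition encodes (c : algnum_code) (x : algC) : Prop :=
  let: (p, (a, b, r)) := c in
  let in_disc (y : algC) := `|y - (ratr a + 'i * ratr b)| < ratr r in
  [/\ p != 0, root (map_poly intr p) x, in_disc x &
      forall y, root (map_poly intr p) y -> in_disc y -> y = x].

(* Codes of beta, of eta, of the elements of S, and of B_0, ..., B_D. *)
Definition input_code : countType :=
  (algnum_code * algnum_code * seq algnum_code * seq algnum_code)%type.

Definition encodes_input (c : input_code) (beta eta : algC) (S B : seq algC)
    : Prop :=
  let: (cbeta, ceta, cS, cB) := c in
  [/\ encodes cbeta beta, encodes ceta eta,
      List.Forall2 encodes cS S & List.Forall2 encodes cB B].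

(* Main.v *)
(** Write the relation as B_0 + sum_j g_j beta^(-j) = 0, where the g_j in Z[beta]
    are the coefficients of sum_(1 <= k <= D) B_k (sum_i s_i X^i)^k.  For n >= 1
    the number Y_n = beta^n (B_0 + sum_(j <= n) g_j beta^(-j)) is nonzero because
    B_0 beta^n is not in Z[beta]; up to a bounded denominator it is an algebraic
    integer, and as the conjugates of beta other than beta and its complex
    conjugate lie in the closed unit disc, its conjugates grow at most
    polynomially in n.  The norm thus gives |Y_n| >= n^(-c).  On the other hand
    -Y_n is beta^n times the tail sum_(j > n) g_j beta^(-j), which is
    exponentially small in the length of the gap of zero g_j following n.  So such
    gaps have length O(log n), and at least c N / log N of the g_j with j < N are
    nonzero.  Each such j is a sum of at most D elements of the support of s, which
    leaves at most (lambda(N) + 1)^D possibilities.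
    The constants only depend on a bound for the sizes and coefficients of the
    polynomials in the input, and the Goedel number of the input is such a bound,
    so they are explicit functions of that number. *)

Require Import Defs.
From HB Require Import structures.
From mathcomp Require Import all_boot all_order all_algebra all_field.
From mathcomp Require Import all_classical all_reals all_analysis.
From mathcomp Require Import zify ring lra.
Set Implicit Arguments.
Unset Strict Implicit.
Unset Printing Implicit Defensive.
Import Order.TTheory GRing.Theory Num.Theory.
Import numFieldNormedType.Exports.
Local Open Scope classical_set_scope.
Local Open Scope ring_scope.

(** * Computability and Goedel numbers *)

(** Lists of every length are allowed, projections reading missing entries as 0, so the closure
    properties carry no arity conditions. *)
Definition recursive (F : seq nat -> nat) : Prop :=
  exists e, forall v, Defs.eval e v (F v).

Lemma recursive_const n : recursive (fun=> n).
Proof.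
elim: n => [|n [e He]]; first by exists Zero => v; exact: eval_Zero.
exists (Comp Succ [:: e]) => v; apply: eval_Comp (eval_Succ [:: n]).
exact: evals_cons (He v) (evals_nil v).
Qed.

Lemma recursive_proj i : recursive (fun v => nth 0%N v i).
Proof. by exists (Proj i) => v; exact: eval_Proj. Qed.

Lemma recursive_comp2 (e : recfun) (op : nat -> nat -> nat) F G :
  (forall m n, Defs.eval e [:: m; n] (op m n)) ->
  recursive F -> recursive G -> recursive (fun v => op (F v) (G v)).
Proof.
move=> He [f Hf] [g Hg]; exists (Comp e [:: f; g]) => v.
apply: eval_Comp (He _ _); apply: evals_cons (Hf v) _.
exact: evals_cons (Hg v) (evals_nil v).
Qed.

Definition add_code := PrimRec (Proj 0) (Comp Succ [:: Proj 1]).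

Lemma eval_add m n : Defs.eval add_code [:: m; n] (m + n)%N.
Proof.
elim: m => [|m IH]; first exact/eval_PrimRec0/(eval_Proj 0 [:: n]).
apply: eval_PrimRecS IH _; rewrite addSn.
apply: eval_Comp (eval_Succ [:: (m + n)%N]).
exact: evals_cons (eval_Proj 1 [:: m, (m + n)%N & [:: n]]) (evals_nil _).
Qed.

Definition mul_code := PrimRec Zero (Comp add_code [:: Proj 2; Proj 1]).

Lemma eval_mul m n : Defs.eval mul_code [:: m; n] (m * n)%N.
Proof.
elim: m => [|m IH]; first exact/eval_PrimRec0/eval_Zero.
apply: eval_PrimRecS IH _; rewrite mulSn; apply: eval_Comp (eval_add _ _).
apply: evals_cons (eval_Proj 2 [:: m, (m * n)%N & [:: n]]) _.
exact: evals_cons (eval_Proj 1 [:: m, (m * n)%N & [:: n]]) (evals_nil _).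
Qed.

(* The second argument is ignored. *)
Definition exp2_code :=
  PrimRec (Comp Succ [:: Zero]) (Comp add_code [:: Proj 1; Proj 1]).

Lemma eval_exp2 m n : Defs.eval exp2_code [:: m; n] (2 ^ m)%N.
Proof.
elim: m => [|m IH].
  apply/eval_PrimRec0/(eval_Comp _ (eval_Succ [:: 0%N])).
  exact: evals_cons (eval_Zero _) (evals_nil _).
apply: eval_PrimRecS IH _.
rewrite expnS mul2n -addnn; apply: eval_Comp (eval_add _ _).
apply: evals_cons (eval_Proj 1 [:: m, (2 ^ m)%N & [:: n]]) _.
exact: evals_cons (eval_Proj 1 [:: m, (2 ^ m)%N & [:: n]]) (evals_nil _).
Qed.

Lemma recursive_add F G :
  recursive F -> recursive G -> recursive (fun v => F v + G v)%N.
Proof. exact: recursive_comp2 eval_add. Qed.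

Lemma recursive_mul F G :
  recursive F -> recursive G -> recursive (fun v => F v * G v)%N.
Proof. exact: recursive_comp2 eval_mul. Qed.

Lemma recursive_exp2 F : recursive F -> recursive (fun v => 2 ^ F v)%N.
Proof.
move=> HF.
exact: (recursive_comp2 (op := fun m _ => (2 ^ m)%N) eval_exp2 HF HF).
Qed.

(** The code of a list [[:: x; y]] unfolds to [2 ^ x * (2 * 2 ^ y + 1)]. *)
Lemma recursive_code2 F G : recursive F -> recursive G ->
  recursive (fun v => CodeSeq.code [:: F v; G v]).
Proof.
move=> HF HG; pose H v := (2 ^ F v * (2 * (2 ^ G v) + 1))%N.
suff -> : (fun v => CodeSeq.code [:: F v; G v]) = H.
  apply: recursive_mul; first exact: recursive_exp2.
  apply: recursive_add; last exact: recursive_const.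
  by apply: recursive_mul; [exact: recursive_const | exact: recursive_exp2].
by apply/funext => v; rewrite /H /= double0 muln1 addn1 mul2n.
Qed.

Lemma pickle_rat (q : rat) :
  pickle q = CodeSeq.code [:: pickle (numq q); pickle (denq q)].
Proof. by []. Qed.

(** An integer is coded as a pair of optional naturals: a present [n] is coded as a singleton list,
    giving [2 ^ n], and an absent one as the empty list, giving 0. *)
Lemma pickle_Posz (n : nat) : pickle n%:Z = CodeSeq.code [:: (2 ^ n)%N; 0%N].
Proof. by rewrite [LHS]/(CodeSeq.code [:: (2 ^ n * 1)%N; 0%N]) muln1. Qed.

Lemma recursive_pickle_Posz F :
  recursive F -> recursive (fun v => pickle (F v)%:Z).
Proof.
move=> HF; under eq_fun do rewrite pickle_Posz.
by apply: recursive_code2; [exact: recursive_exp2 | exact: recursive_const].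
Qed.

Lemma computable_nat (T : countType) F : recursive F ->
  computable (fun x : T => (F [:: pickle x])%:R : rat).
Proof.
move=> HF.
have [e He] : recursive (fun v => pickle ((F v)%:R : rat)).
  under eq_fun do rewrite pickle_rat pmulrn numq_int denq_int.
  by apply: recursive_code2; [|exact: recursive_const];
    apply: recursive_pickle_Posz.
by exists e => x; exact: He.
Qed.

Lemma computable_natV (T : countType) F : recursive F ->
  computable (fun x : T => (F [:: pickle x]).+1%:R^-1 : rat).
Proof.
move=> HF.
have inv_rat n : n.+1%:R^-1 = @Rat (1, n.+1%:Z) (coprime1n n.+1).
  by rewrite -[RHS]divq_num_den mul1r.
have [e He] : recursive (fun v => pickle ((F v).+1%:R^-1 : rat)).
  have -> : (fun v => pickle ((F v).+1%:R^-1 : rat)) =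
      fun v => CodeSeq.code [:: pickle 1%:Z; pickle (F v + 1)%N%:Z].
    by apply/funext => v; rewrite inv_rat addn1.
  apply: recursive_code2; first exact: recursive_const.
  by apply/recursive_pickle_Posz/recursive_add => //; exact: recursive_const.
by exists e => x; exact: He.
Qed.

(** A Goedel number dominates all the data it encodes. Iterating this lets the code of the input
    bound every degree and coefficient in it. *)
Lemma pickle_pair_ge (T U : countType) (x : T) (y : U) :
  (pickle x <= pickle (x, y))%N /\ (pickle y <= pickle (x, y))%N.
Proof.
have := CodeSeq.ltn_code [:: pickle x; pickle y].
rewrite -[CodeSeq.code _]/(pickle (x, y)) => /and3P[/ltnW ? /ltnW ? _].
by split.
Qed.

Lemma pickle_seq_ge (T : countType) (s : seq T) x :
  x \in s -> (pickle x <= pickle s)%N.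
Proof.
move=> xs; apply: ltnW; have /allP := CodeSeq.ltn_code (map pickle s).
by apply; rewrite map_f.
Qed.

Lemma size_le_pickle (T : countType) (s : seq T) : (size s <= pickle s)%N.
Proof.
rewrite -[pickle s]/(CodeSeq.code (map pickle s)).
elim: s => //= x s IH; rewrite -[(size s).+1]mul1n leq_mul ?expn_gt0 // ltnS.
by rewrite (leq_trans IH) // -addnn leq_addr.
Qed.

Lemma absz_le_pickle (z : int) : (`|z| <= pickle z)%N.
Proof.
case: z => n; last first.
  have := CodeSeq.ltn_code [:: 0%N; (2 ^ n * 1)%N].
  rewrite -[CodeSeq.code _]/(pickle (Negz n)) muln1 => /and3P[_ H _].
  by apply: leq_trans H; rewrite ltnS /= ltnW // ltn_expl.
have := CodeSeq.ltn_code [:: (2 ^ n * 1)%N; 0%N].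
rewrite -[CodeSeq.code _]/(pickle (Posz n)) muln1 => /and3P[H _ _].
by apply: leq_trans (ltnW H); rewrite /= ltnW // ltn_expl.
Qed.

Lemma size_poly_le_pickle (p : {poly int}) : (size p <= pickle p)%N.
Proof. exact: size_le_pickle (polyseq p). Qed.

Lemma coef_le_pickle (p : {poly int}) i : (`|(p`_i)%R| <= pickle p)%N.
Proof.
have [ip|ip] := ltnP i (size p); last by rewrite nth_default.
apply: leq_trans (absz_le_pickle _) _.
exact: @pickle_seq_ge _ (polyseq p) _ (mem_nth _ ip).
Qed.

(** * Conjugates *)

Local Notation QtoC := (map_poly (ratr : rat -> algC)).

Lemma minPoly_ratr (L : fieldExtType rat) (phi : {rmorphism L -> algC}) x :
  exists p, map_poly phi (minPoly 1 x) = QtoC p.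
Proof.
have aP i : (minPoly 1 x)`_i \in 1%VS by exact/polyOverP/minPolyOver.
have {}aP i := vlineP _ _ (aP i).
have [a Da] := choice aP.
exists (\poly_(i < size (minPoly 1 x)) a i); apply/polyP => i.
rewrite !coef_map coef_poly /=.
case: ifP => [_|/negbT]; last first.
  by rewrite -leqNgt => ?; rewrite nth_default // !rmorph0.
by rewrite Da alg_num_field fmorph_rat.
Qed.

(** The roots of [minCpoly x] generate a number field [L] that is normal over the rationals. There
    the conjugates of [x] are its Galois images, and a Galois automorphism of [L] extends to
    [algC]. *)
Lemma conjugate_aut x z :
  conjugate x z -> exists nu : {rmorphism algC -> algC}, nu x = z.
Proof.
rewrite /conjugate => xz.
have [q [Dq mon_q] min_q] := minCpolyP x.
have [r Dr] := closed_field_poly_normal (minCpoly x).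
rewrite (monicP (minCpoly_monic x)) scale1r in Dr.
have [L [phi [s Ds genL]]] := num_field_exists r.
pose p : {poly L} := map_poly (in_alg L) q.
have Dp : p = \prod_(y <- s) ('X - y%:P).
  apply: (map_poly_inj phi); rewrite rmorph_prod.
  transitivity (minCpoly x).
    rewrite Dq -map_poly_comp; apply: eq_map_poly => a /=.
    by rewrite alg_num_field fmorph_rat.
  by rewrite Dr -Ds big_map; apply: eq_bigr => y _; rewrite rmorphB /= map_polyX map_polyC.
have splitL : splitting_field_axiom L.
  exists p; first by apply/polyOver_poly => i _; rewrite memvZ ?mem1v.
  by exists s => //; rewrite Dp eqpxx.
pose LM := FieldExt_isSplittingField.Build _ L splitL.
pose Ls : splittingFieldType rat := HB.pack (FieldExt.sort L) LM.
have normL : normalField 1 {:Ls} by apply/splitting_normalField; rewrite ?sub1v.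
have memr y : root (minCpoly x) y -> exists2 y1 : Ls, phi y1 = y & y1 \in s.
  by rewrite Dr root_prod_XsubC -Ds => /mapP[y1 ? ->]; exists y1.
have [x1 Dx1 _] := memr _ (root_minCpoly x).
have [z1 Dz1 _] := memr _ xz.
have /(_ x1 (memvf _)) [t _ Dt] := normalField_factors (sub1v _) normL.
have : root (minPoly 1 x1) z1.
  have [q1 Dq1] := minPoly_ratr phi x1.
  rewrite -(fmorph_root phi) Dq1 Dz1.
  have : root (QtoC q1) x by rewrite -Dq1 -Dx1 fmorph_root root_minPoly.
  rewrite min_q => /dvdpP[w ->]; rewrite rmorphM rootM /= -Dq.
  by apply/orP; right.
rewrite Dt -(big_map (fun g : gal_of {:Ls} => g x1) predT
  (fun y => 'X - y%:P)) root_prod_XsubC => /mapP[g _ Dg].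
have gM : monoid_morphism (g : Ls -> Ls).
  exact/kHom_monoid_morphism/k1AHom.
pose gRM : {rmorphism Ls -> Ls} := HB.pack (fun_of_lfun (gal_repr g))
  (GRing.isMonoidMorphism.Build _ _ (g : Ls -> Ls) gM).
have [nu Dnu] := extend_algC_subfield_aut phi gRM.
by exists nu; rewrite -Dx1 -Dnu -Dz1 Dg.
Qed.

Lemma aut_conjugate (nu : {rmorphism algC -> algC}) x : conjugate x (nu x).
Proof. by rewrite /conjugate -(minCpoly_aut nu) root_minCpoly. Qed.

Lemma root_intr_aut (p : {poly int}) (nu : {rmorphism algC -> algC}) x :
  root (map_poly intr p) x -> root (map_poly intr p) (nu x).
Proof.
rewrite -(fmorph_root nu) -map_poly_comp.
by rewrite (@eq_map_poly _ _ _ intr) // => a; rewrite /= rmorph_int.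
Qed.

(** Cauchy's root bound. If [|x| > m + 1], the terms of degree below [k] add up to at most
    [|x| ^ k - 1], too little to cancel the leading term, whose coefficient has modulus at least
    1. *)
Lemma norm_root_le (p : {poly int}) (m : nat) (x : algC) :
  p != 0 -> (forall i, (`|(p`_i)%R| <= m)%N) -> root (map_poly intr p) x ->
  `|x| <= m.+1%:R.
Proof.
move=> p0 pm px; rewrite real_leNgt ?realn ?normr_real //; apply/negP => xm.
have x1 : 1 < `|x| by apply: le_lt_trans xm; rewrite ler1n.
have [n szp] : exists n, size p = n.+1.
  by exists (size p).-1; rewrite prednK // size_poly_gt0.
have lead1 : (1 : algC) <= `|(lead_coef p)%:~R|.
  by apply: norm_intr_ge1; rewrite ?intr_int // intr_eq0 lead_coef_eq0.
have geo k : `|\sum_(i < k) (p`_i)%:~R * x ^+ i| <= `|x| ^+ k - 1.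
  elim: k => [|k IH]; first by rewrite big_ord0 normr0 expr0 subrr.
  rewrite big_ord_recr /= (le_trans (ler_normD _ _)) //.
  rewrite (le_trans (lerD IH (lexx _))) // normrM normrX.
  have pk : `|(p`_k)%:~R| <= m%:R :> algC.
    by rewrite -intr_norm -abszE -pmulrn ler_nat.
  have xk : 0 <= `|x| ^+ k by rewrite exprn_ge0.
  rewrite exprS; have : `|(p`_k)%:~R| * `|x| ^+ k <= (`|x| - 1) * `|x| ^+ k.
    rewrite ler_wpM2r // (le_trans pk) // lerBrDr (le_trans _ (ltW xm)) //.
    by rewrite -[m.+1]addn1 natrD.
  by rewrite mulrBl mul1r => H; rewrite addrAC lerD2r addrC -lerBrDr.
have := geo n; move: px; rewrite rootE horner_coef size_map_inj_poly //; last first.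
  exact: intr_inj.
rewrite szp big_ord_recr /= coef_map /=.
under eq_bigr do rewrite coef_map.
rewrite addr_eq0 => /eqP ->; rewrite normrN normrM normrX.
have xn : 0 <= `|x| ^+ n by rewrite exprn_ge0.
have : `|x| ^+ n <= `|(p`_n)%:~R| * `|x| ^+ n.
  by rewrite ler_peMl // -[n]/(n.+1.-1) -szp.
by move=> /le_trans H /H; rewrite lerBrDr gerDl ler10.
Qed.

(** Let [g] be the gcd of [q] and its derivative. As [x] is a root of [q / g] or of [g], the minimal
    polynomial [q] divides one of them: the first makes [g] constant, the second makes [q] divide
    its nonzero derivative. *)
Lemma separable_minCpoly x : separable_poly (minCpoly x).
Proof.
have [q [Dq mon_q] min_q] := minCpolyP x.
have q0 : q != 0 by apply: monic_neq0.
have szq : (1 < size q)%N by rewrite -(size_map_poly (ratr : rat -> algC)) -Dq size_minCpoly.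
have qx : root (QtoC q) x by rewrite min_q.
have dq0 : q^`() != 0.
  apply/negP => /eqP/(congr1 (fun p : {poly rat} => p`_(size q).-2)).
  rewrite coef_deriv coef0 prednK -?subn1 ?subn_gt0 // subn1 -/(lead_coef q).
  by rewrite (monicP mon_q) => /eqP; rewrite pnatr_eq0; lia.
rewrite Dq separable_map unlock.
have Dg := divpK (dvdp_gcdl q q^`()).
move: qx; rewrite -{1}Dg rmorphM rootM /= !min_q => /orP[qg|].
  have g0 : gcdp q q^`() != 0 by rewrite gcdp_eq0 (negPf q0).
  have qg0 : q %/ gcdp q q^`() != 0.
    by apply: contraNneq q0 => E; rewrite -Dg E mul0r.
  have := dvdp_leq qg0 qg; rewrite size_divp // /coprimep.
  move: g0; rewrite -size_poly_gt0.
  by move: (size _) (size _) szq => a b; lia.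
move=> /dvdp_trans/(_ (dvdp_gcdr _ _))/(dvdp_leq dq0).
by rewrite leqNgt lt_size_deriv.
Qed.

(* The roots of [minCpoly x] are distinct, and their product is a nonzero
   integer up to sign. *)
Lemma liouville (x : algC) (H : algC) (t : seq algC) :
  x != 0 -> x \in Aint -> 1 <= H ->
  (forall z, conjugate x z -> `|z| <= H /\ z \in t) ->
  1 <= `|x| * H ^+ size t.
Proof.
move=> x0 xA H1 Hz.
have [r Dr] := closed_field_poly_normal (minCpoly x).
rewrite (monicP (minCpoly_monic x)) scale1r in Dr.
have rP z : (z \in r) = conjugate x z by rewrite /conjugate Dr root_prod_XsubC.
have ur : uniq r.
  by rewrite -separable_prod_XsubC -Dr separable_minCpoly.
have xr : x \in r by rewrite rP /conjugate root_minCpoly.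
(* Only the length of [t] matters: having distinct entries, all in [t], the list [r] shows that the
   degree of [x] is at most [size t]. *)
have szr : (size r <= size t)%N.
  by apply: uniq_leq_size => // z; rewrite rP => /Hz[].
have prod1 : 1 <= \prod_(z <- r) `|z|.
  have -> : \prod_(z <- r) `|z| = `|(minCpoly x)`_0|.
    rewrite -horner_coef0 Dr horner_prod normr_prod; apply: eq_bigr => z _.
    by rewrite hornerXsubC sub0r normrN.
  apply: norm_intr_ge1; first exact: (polyOverP xA).
  rewrite -horner_coef0 -rootE -/(conjugate x 0); apply/negP => c0.
  have [nu] := conjugate_aut c0; move/eqP; rewrite fmorph_eq0; exact/negP.
apply: le_trans prod1 _; rewrite (big_rem x) //= ler_wpM2l //.
apply: le_trans (_ : \prod_(z <- rem x r) H <= _).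
  rewrite !big_seq; apply: ler_prod => z /mem_rem.
  by rewrite rP normr_ge0 => /Hz[].
rewrite big_const_seq count_predT size_rem // iter_mulr_1 ler_weXn2l //.
exact: leq_trans (leq_pred _) szr.
Qed.

(** * The coefficients of the power series *)

Section DigitForm.
Variables (K : comNzRingType) (D : nat) (B s : nat -> K).

(** The sum starts at [k = 1]: [B 0] is kept apart, since it need not lie in Z[beta]. *)
Definition digit_form N : {poly K} :=
  \sum_(1 <= k < D.+1) B k *: (\poly_(i < N) s i) ^+ k.

(* Truncating at [j.+1] digits does not affect the coefficient of ['X^j], so
   this is the coefficient of the full power series. *)
Definition digit_coef j : K := (digit_form j.+1)`_j.

(* [b ^+ n] times the sum of [B 0] and of the terms of order at most [n] of that
   power series at [1 / b]; it is a polynomial in [b], up to [B 0]. *)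
Definition digit_head (b : K) (n : nat) : K :=
  B 0 * b ^+ n + \sum_(j < n.+1) digit_coef j * b ^+ (n - j).

Lemma coef_digit_form N j :
  (digit_form N)`_j = \sum_(1 <= k < D.+1) B k * ((\poly_(i < N) s i) ^+ k)`_j.
Proof. by rewrite coef_sum; apply: eq_bigr => k _; rewrite coefZ. Qed.

Lemma coef_exp_eq (p q : {poly K}) n :
  (forall i, (i <= n)%N -> p`_i = q`_i) ->
  forall k i, (i <= n)%N -> (p ^+ k)`_i = (q ^+ k)`_i.
Proof.
move=> pq; elim=> [|k IH] i ni; first by rewrite !expr0.
rewrite !exprS !coefM; apply: eq_bigr => j _.
by rewrite pq ?IH // (leq_trans _ ni) // ?leq_subr // -ltnS.
Qed.

Lemma digit_form_coef N j : (j < N)%N -> (digit_form N)`_j = digit_coef j.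
Proof.
move=> jN; rewrite /digit_coef !coef_digit_form; apply: eq_bigr => k _.
congr (_ * _); apply: (@coef_exp_eq _ _ j) => // i ij.
by rewrite !coef_poly ltnS ij (leq_ltn_trans ij).
Qed.

Lemma horner_digit_form N x :
  (digit_form N).[x] =
  \sum_(1 <= k < D.+1) B k * (\sum_(i < N) s i * x ^+ i) ^+ k.
Proof.
rewrite horner_sum; apply: eq_bigr => k _.
by rewrite hornerZ horner_exp horner_poly.
Qed.

Definition support N : seq nat := [seq i <- iota 0 N | s i != 0].

(** Adjoining 0 to the support makes these lists increase with [k]. Repetitions are kept, so that
    the length is an exact power. *)
Fixpoint sumset N k : seq nat :=
  if k is k'.+1 then
    [seq (i + j)%N | i <- 0%N :: support N, j <- sumset N k']
  else [:: 0%N].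

Lemma size_sumset N k : size (sumset N k) = ((size (support N)).+1 ^ k)%N.
Proof.
elim: k => //= k IH.
by rewrite size_cat size_map size_allpairs IH expnS mulSn.
Qed.

Lemma sumset_homo N k l : (k <= l)%N -> {subset sumset N k <= sumset N l}.
Proof.
elim: l => [|l IH]; first by rewrite leqn0 => /eqP ->.
rewrite leq_eqVlt => /predU1P[->//|/IH {}IH] j /IH jl.
by apply/allpairsP; exists (0%N, j); rewrite mem_head.
Qed.

Lemma coef_exp_sumset N k j : (j < N)%N ->
  ((\poly_(i < N) s i) ^+ k)`_j != 0 -> j \in sumset N k.
Proof.
elim: k j => [|k IH] j jN.
  by rewrite expr0 coef1 inE; case: (j == 0%N); rewrite ?eqxx.
rewrite exprS coefM => nz.
have [i nzi] : exists i : 'I_j.+1,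
    (\poly_(i < N) s i)`_i * ((\poly_(i < N) s i) ^+ k)`_(j - i) != 0.
  apply/existsP; apply: contraT; rewrite negb_exists => /forallP z.
  by rewrite big1 ?eqxx // in nz => i _; apply/eqP; rewrite -[_ == _]negbK z.
have iN : (i < N)%N by apply: leq_ltn_trans jN; rewrite -ltnS.
have si : s i != 0.
  by apply: contraNneq nzi => si; rewrite coef_poly iN si mul0r.
have nzk : ((\poly_(i < N) s i) ^+ k)`_(j - i) != 0.
  by apply: contraNneq nzi => ->; rewrite mulr0.
apply/allpairsP; exists (val i, (j - i)%N); split => /=.
- by rewrite inE mem_filter si mem_iota iN orbT.
- by apply: IH => //; rewrite (leq_ltn_trans (leq_subr _ _)).
- by rewrite subnKC // -ltnS.
Qed.

Lemma digit_coef_sumset N j :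
  (j < N)%N -> digit_coef j != 0 -> j \in sumset N D.
Proof.
move=> jN; rewrite -(digit_form_coef jN) coef_digit_form => nz.
have [k kD nzk] : exists2 k, (k <= D)%N & ((\poly_(i < N) s i) ^+ k)`_j != 0.
  apply: contra_notP (negP nz) => H; rewrite big1_seq // => k.
  rewrite mem_index_iota ltnS => /= /andP[_ kD].
  by have [->|?] := eqVneq ((\poly_(i < N) s i) ^+ k)`_j 0;
    [rewrite mulr0 | case: H; exists k].
exact/(sumset_homo kD)/coef_exp_sumset.
Qed.

End DigitForm.

(** Compatibility with ring morphisms serves twice: for automorphisms, to conjugate the heads, and
    for evaluation at [beta], to show that their digit part lies in Z[beta]. *)
Lemma map_digit_form (K K' : comNzRingType) (f : {rmorphism K -> K'}) D B s N :
  map_poly f (digit_form D B s N) = digit_form D (f \o B) (f \o s) N.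
Proof.
apply/polyP => j; rewrite coef_map /= !coef_digit_form rmorph_sum.
apply: eq_bigr => k _; rewrite rmorphM /= -coef_map rmorphXn /=.
congr (_ * (polyseq (_ ^+ _))`_j); apply/polyP => i; rewrite coef_map !coef_poly /=.
by case: ifP => // _; rewrite rmorph0.
Qed.

Lemma rmorph_digit_coef (K K' : comNzRingType) (f : {rmorphism K -> K'}) D B s j :
  f (digit_coef D B s j) = digit_coef D (f \o B) (f \o s) j.
Proof. by rewrite /digit_coef -map_digit_form coef_map. Qed.

Lemma rmorph_digit_head (K K' : comNzRingType) (f : {rmorphism K -> K'})
    D B s b n :
  f (digit_head D B s b n) = digit_head D (f \o B) (f \o s) (f b) n.
Proof.
rewrite rmorphD rmorphM rmorphXn rmorph_sum; congr (_ + _).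
apply: eq_bigr => j _.
by rewrite rmorphM rmorphXn rmorph_digit_coef.
Qed.

Lemma eq_digit_coef (K : comNzRingType) D (B B' s s' : nat -> K) j :
  (forall k, (0 < k <= D)%N -> B k = B' k) -> s =1 s' ->
  digit_coef D B s j = digit_coef D B' s' j.
Proof.
move=> BB ss; rewrite /digit_coef !coef_digit_form.
apply: eq_big_nat => k kD; rewrite BB //; congr (_ * _).
apply: (@coef_exp_eq _ _ _ j) => // i ij.
by rewrite !coef_poly ss.
Qed.

Lemma eq_digit_head (K : comNzRingType) D (B B' s s' : nat -> K) b n :
  (forall k, (k <= D)%N -> B k = B' k) -> s =1 s' ->
  digit_head D B s b n = digit_head D B' s' b n.
Proof.
move=> BB ss; rewrite /digit_head BB //; congr (_ + _).
apply: eq_bigr => j _; rewrite (@eq_digit_coef _ _ _ B' _ s') //.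
by move=> k /andP[_ /BB].
Qed.

(** Each further factor [p] is a convolution with [j.+1] terms, which costs a factor [H * j.+1]. *)
Lemma coef_exp_le (p : {poly algC}) (H : algC) k j :
  0 <= H -> (forall i, `|p`_i| <= H) -> `|(p ^+ k)`_j| <= (H * j.+1%:R) ^+ k.
Proof.
move=> H0 pH; elim: k j => [|k IH] j.
  by rewrite !expr0 coef1; case: eqP => _; rewrite ?normr1 ?normr0.
rewrite exprS coefM (le_trans (ler_norm_sum _ _ _)) //.
apply: (@le_trans _ _ (\sum_(i < j.+1) H * (H * j.+1%:R) ^+ k)).
  apply: ler_sum => i _; rewrite normrM ler_pM //.
  rewrite (le_trans (IH _)) // lerXn2r ?nnegrE ?mulr_ge0 //.
  by rewrite ler_wpM2l // ler_nat ltnS leq_subr.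
by rewrite sumr_const card_ord -[leLHS]mulr_natl mulrA [_%:R * H]mulrC -exprS.
Qed.

Lemma digit_form_coef_le D (B s : nat -> algC) (H : algC) N j :
  1 <= H -> (forall k, (0 < k <= D)%N -> `|B k| <= H) ->
  (forall i, `|s i| <= H) ->
  `|(digit_form D B s N)`_j| <= D%:R * H ^+ D.+1 * j.+1%:R ^+ D.
Proof.
move=> H1 BH sH; have H0 : 0 <= H by apply: le_trans H1.
rewrite coef_digit_form (le_trans (ler_norm_sum _ _ _)) //.
apply: (@le_trans _ _ (\sum_(1 <= k < D.+1) H * (H * j.+1%:R) ^+ D)).
  rewrite !big_nat; apply: ler_sum => k /andP[k0 kD].
  rewrite normrM ler_pM // ?BH ?k0 //.
  apply: le_trans (coef_exp_le _ _ H0 _) _ => [i|].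
    by rewrite coef_poly; case: ifP => _; rewrite ?sH ?normr0.
  by rewrite ler_weXn2l // mulr_ege1 // ler1n.
rewrite sumr_const_nat subn1 /= -[leLHS]mulr_natl exprMn exprS.
by rewrite !mulrA.
Qed.

(** * Arithmetic lower bound *)

Lemma leq_expr2l m n e : (m <= n)%N -> (m ^ e <= n ^ e)%N.
Proof. by case: e => // e; rewrite leq_exp2r. Qed.

Definition poly_eval (beta : algC) : {rmorphism {poly int} -> algC} :=
  horner_eval beta \o map_poly intr.

Lemma in_Zadjoin_Aint beta x : beta \in Aint -> in_Zadjoin beta x -> x \in Aint.
Proof.
move=> betaA [p ->]; apply: rpred_horner => //.
by apply/polyOverP => i; rewrite coef_map Aint_int.
Qed.

(** Conjugates of an element of Z[beta] are determined by the image of [beta], hence no more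
    numerous than the conjugates of [beta]. *)
Lemma in_Zadjoin_aut beta x (nu nu' : {rmorphism algC -> algC}) :
  nu beta = nu' beta -> in_Zadjoin beta x -> nu x = nu' x.
Proof.
move=> nub [p ->]; rewrite -!horner_map nub -!map_poly_comp.
by congr (_.[_]); apply: eq_map_poly => c; rewrite /= !rmorph_int.
Qed.

Lemma in_Qadjoin_aut beta x (nu nu' : {rmorphism algC -> algC}) :
  nu beta = nu' beta -> in_Qadjoin beta x -> nu x = nu' x.
Proof.
move=> nub [p [q [_ ->]]].
have E u : nu (map_poly ratr u).[beta] = nu' (map_poly ratr u).[beta].
  rewrite -!horner_map nub -!map_poly_comp.
  by congr (_.[_]); apply: eq_map_poly => c; rewrite /= !fmorph_rat.
by rewrite !fmorph_div !E.
Qed.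

(** With [a] the leading coefficient and [n.+1] the degree, multiplying [p(x) = 0] by [a ^ n] gives
    a monic integral equation for [a * x], with lower coefficients [p_i * a ^ (n - i)]. *)
Lemma lead_coef_mul_Aint (p : {poly int}) (x : algC) :
  p != 0 -> root (map_poly intr p) x -> (lead_coef p)%:~R * x \in Aint.
Proof.
move=> p0 px; have [n szp] : exists n, size p = n.+1.
  by exists (size p).-1; rewrite prednK // size_poly_gt0.
case: n szp => [|n] szp.
  move: px; rewrite (size1_polyC (_ : size p <= 1)%N) ?szp // map_polyC rootC.
  rewrite intr_eq0 => /eqP p00; case/eqP: p0.
  by rewrite [p]size1_polyC ?szp // p00.
pose a := lead_coef p.
pose q : {poly int} := 'X^(n.+1) + \poly_(i < n.+1) (p`_i * a ^+ (n - i)).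
have szq : size (map_poly intr q : {poly algC}) = n.+2.
  rewrite size_map_inj_poly //; last exact: intr_inj.
  by rewrite size_polyDl size_polyXn // ltnS size_poly.
have qE i : (i < n.+1)%N ->
    (map_poly intr q)`_i = (p`_i)%:~R * a%:~R ^+ (n - i) :> algC.
  move=> ni; rewrite coef_map /= coefD coefXn coef_poly ni ltn_eqF // add0r.
  by rewrite intrM rmorphXn.
have qn : (map_poly intr q)`_n.+1 = 1 :> algC.
  by rewrite coef_map /= coefD coefXn eqxx coef_poly ltnn addr0.
apply: (@root_monic_Aint (map_poly intr q)).
- rewrite rootE horner_coef szq big_ord_recr /= qn mul1r.
  have -> : \sum_(i < n.+1) (map_poly intr q)`_i * (a%:~R * x) ^+ i =
      a%:~R ^+ n * \sum_(i < n.+1) (p`_i)%:~R * x ^+ i.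
    rewrite mulr_sumr; apply: eq_bigr => i _; rewrite qE // exprMn.
    have -> : a%:~R ^+ n = a%:~R ^+ (n - i) * a%:~R ^+ i :> algC.
      by rewrite -exprD subnK // -ltnS.
    by ring.
  move: px; rewrite rootE horner_coef size_map_inj_poly //; last exact: intr_inj.
  rewrite szp big_ord_recr /= coef_map /= -[n.+1]/(n.+2.-1) -szp -/(lead_coef p) -/a.
  under eq_bigr do rewrite coef_map /=.
  move=> /eqP px; have -> : (a%:~R * x) ^+ (size p).-1 =
      a%:~R ^+ n * (a%:~R * x ^+ (size p).-1).
    by rewrite szp /= exprMn [in LHS]exprS; ring.
  by rewrite -mulrDr px mulr0.
- by rewrite monicE lead_coefE szq /= qn.
- by apply/polyOverP => i; rewrite coef_map intr_int.
Qed.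

(* Liouville's bound for [beta * beta^* - 1]. *)
Lemma norm_gt1_gap (beta : algC) (h : nat) (r : seq algC) :
  beta \in Aint -> 1 < `|beta| ->
  (forall z, conjugate beta z -> `|z| <= h%:R /\ z \in r) ->
  1 <= (`|beta| ^+ 2 - 1) * (h ^ 2 + 1)%:R ^+ (size r * size r).
Proof.
move=> betaA beta1 conjb.
have gamma : `|beta| ^+ 2 - 1 = beta * beta^* - 1 by rewrite normCK.
have sq1 : 0 < `|beta| ^+ 2 - 1 by rewrite subr_gt0 exprn_egt1.
rewrite -[X in X * _]gtr0_norm // gamma -(size_allpairs (fun y z => y * z - 1)).
apply: liouville => [|||z].
- by rewrite -gamma gt_eqF.
- by rewrite rpredB ?rpred1 // rpredM // Aint_aut.
- by rewrite ler1n addn1.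
(* A conjugate of the product minus 1 is [y * z - 1] with [y] and [z] both conjugates of [beta];
   this accounts for the [size r * size r] candidates and for the bound [h ^ 2 + 1]. *)
move=> /conjugate_aut[nu <-]; rewrite rmorphB rmorphM rmorph1.
have [nb1 nbr1] := conjb _ (aut_conjugate nu beta).
have [nb2 nbr2] := conjb _ (aut_conjugate (nu \o (@Num.conj algC)) beta).
split; last by apply/allpairsP; exists (nu beta, nu beta^*).
apply: le_trans (ler_normB _ _) _; rewrite normr1 natrD lerD2r normrM natrX.
by rewrite expr2 ler_pM.
Qed.

Section Head.
Variables (beta : algC) (D : nat) (B s : nat -> algC) (a h : nat) (r : seq algC).
Hypothesis betaA : beta \in Aint.
Hypothesis conjb : forall z, conjugate beta z ->
  z \in r /\ [\/ `|z| <= 1, z = beta | z = beta^*].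
Hypothesis h_gt0 : (0 < h)%N.
Hypothesis sH : forall (nu : {rmorphism algC -> algC}) i, `|nu (s i)| <= h%:R.
Hypothesis BH : forall (nu : {rmorphism algC -> algC}) k,
  (k <= D)%N -> `|nu (B k)| <= h%:R.
Hypothesis sZ : forall i, in_Zadjoin beta (s i).
Hypothesis BZ : forall k, (0 < k <= D)%N -> in_Zadjoin beta (B k).
Hypothesis B0Q : in_Qadjoin beta (B 0).
Hypothesis a_gt0 : (0 < a)%N.
Hypothesis aB0 : a%:R * B 0 \in Aint.
Hypothesis B0Z : forall n, (0 < n)%N -> ~ in_Zadjoin beta (B 0 * beta ^+ n).

Lemma digit_tail_Zadjoin n :
  in_Zadjoin beta (\sum_(j < n.+1) digit_coef D B s j * beta ^+ (n - j)).
Proof.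
have [S DS] := choice sZ.
(* Digits and coefficients are lifted to integer polynomials. The index 0 gets a dummy lift, as
   [digit_coef] only involves [B k] for [0 < k <= D]. *)
have [|T DT] := @choice nat {poly int}
    (fun k p => (0 < k <= D)%N -> B k = poly_eval beta p).
  move=> k; have [kD|_] := boolP (0 < k <= D)%N; last by exists 0.
  by have [p Dp] := BZ kD; exists p.
exists (\sum_(j < n.+1) digit_coef D T S j * 'X ^+ (n - j)).
rewrite -[RHS]/(poly_eval beta _) rmorph_sum; apply: eq_bigr => j _.
rewrite rmorphM rmorphXn rmorph_digit_coef; congr (_ * _ ^+ _).
  by apply: eq_digit_coef => [k /DT|i]; [| rewrite DS].
by rewrite /= /horner_eval map_polyX hornerX.
Qed.

Lemma digit_head_Aint n : a%:R * digit_head D B s beta n \in Aint.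
Proof.
rewrite mulrDr mulrA; apply: rpredD; first by rewrite rpredM ?rpredX.
apply: rpredM; first by rewrite Aint_Cnat.
exact: in_Zadjoin_Aint betaA (digit_tail_Zadjoin n).
Qed.

Lemma digit_head_neq0 n : (0 < n)%N -> digit_head D B s beta n != 0.
Proof.
move=> n0; apply/negP; rewrite addr_eq0 => /eqP E; apply: (B0Z n0).
have [p Dp] := digit_tail_Zadjoin n; exists (- p).
by rewrite E Dp -[RHS]/(poly_eval beta _) rmorphN.
Qed.

Lemma digit_head_aut (nu nu' : {rmorphism algC -> algC}) n :
  nu beta = nu' beta ->
  nu (digit_head D B s beta n) = nu' (digit_head D B s beta n).
Proof.
move=> nub; rewrite !rmorph_digit_head nub; apply: eq_digit_head => [k kD|i] /=.
  case: k kD => [_|k kD]; first exact: in_Qadjoin_aut nub B0Q.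
  exact: in_Zadjoin_aut nub (BZ _).
exact: in_Zadjoin_aut nub (sZ _).
Qed.

(* An automorphism sending [beta] to [beta] or [beta^*] preserves [`|X|]; any
   other one sends [beta] into the closed unit disc, where [digit_head] is at
   most polynomial in [n]. *)
Lemma digit_head_liouville n (X := a%:R * digit_head D B s beta n) :
  (0 < n)%N -> `|X| <= 1 ->
  1 <= `|X| * (a * (h + n.+1 * (D * h ^ D.+1 * n.+1 ^ D)))%:R ^+ size r.
Proof.
move=> n0 X1; set H' := (a * _)%N.
have H'1 : 1 <= H'%:R :> algC by rewrite ler1n muln_gt0 a_gt0 addn_gt0 h_gt0.
(* Since [nu X] depends only on [nu beta], a function [F] takes each conjugate of [beta] to the
   matching conjugate of [X]. Thus [map F r] contains all conjugates of [X] and is no longer than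
   [r]. *)
have [|F DF] := @choice algC algC
    (fun y z => forall nu : {rmorphism algC -> algC}, nu beta = y -> nu X = z).
  move=> y.
  have [[nu0 nu0y]|nex] := pselect (exists nu : {rmorphism algC -> algC}, nu beta = y).
    exists (nu0 X) => nu nuy; rewrite !rmorphM !rmorph_nat; congr (_ * _).
    by apply: digit_head_aut; rewrite nuy.
  by exists 0 => nu nuy; case: nex; exists nu.
rewrite -(size_map F); apply: liouville => //.
- by rewrite mulf_neq0 ?digit_head_neq0 // pnatr_eq0 -lt0n.
- exact: digit_head_Aint.
move=> z /conjugate_aut[nu <-].
have [nur nuD] := conjb (aut_conjugate nu beta).
split; last by rewrite (DF _ nu erefl) map_f.
case: nuD => [nub|nub|nub].
- rewrite rmorphM rmorph_nat normrM normr_nat natrM ler_wpM2l //.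
  rewrite rmorph_digit_head natrD (le_trans (ler_normD _ _)) //.
  have powb k : `|nu beta ^+ k| <= 1 by rewrite normrX exprn_ile1.
  apply: lerD.
    by rewrite normrM -[leRHS]mulr1 ler_pM // BH.
  rewrite (le_trans (ler_norm_sum _ _ _)) //.
  rewrite natrM mulr_natl -[X in _ *+ X]card_ord -sumr_const.
  apply: ler_sum => j _; rewrite normrM -[leRHS]mulr1 ler_pM //.
  have h1 : 1 <= h%:R :> algC by rewrite ler1n.
  apply: le_trans (digit_form_coef_le _ _ h1 _ _) _ => [k /andP[_ kD]|i|].
  - exact: BH.
  - exact: sH.
  by rewrite -!(natrM, natrX) ler_nat leq_mul // leq_expr2l.
(* In this case and the next, the conjugate has the modulus of [X], which is at most 1 by assumption
   and so at most [H']. *)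
- rewrite (_ : nu X = X) ?(le_trans X1) //.
  by rewrite rmorphM rmorph_nat (digit_head_aut _ (nu' := idfun)).
- rewrite (_ : nu X = X^*) ?norm_conjC ?(le_trans X1) //.
  by rewrite !rmorphM !rmorph_nat (digit_head_aut _ (nu' := (@Num.conj algC))).
Qed.

End Head.

(** * Tail estimate *)

(** By convexity the power lies below its chord between [d = 0] and [d = 1]. *)
Lemma expr1D_le (d : algC) k :
  0 <= d <= 1 -> (1 + d) ^+ k <= 1 + (2 ^+ k - 1) * d.
Proof.
case/andP=> d0 d1; elim: k => [|k IH]; first by rewrite !expr0 subrr mul0r addr0.
rewrite exprSr (le_trans (ler_wpM2r _ IH)) ?addr_ge0 // exprS.
have c0 : 0 <= 2 ^+ k - 1 :> algC by rewrite subr_ge0 exprn_ege1 // ler1n.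
set c := 2 ^+ k - 1 in c0 *; have cdd : c * d * d <= c * d.
  by rewrite -[leRHS]mulr1 ler_wpM2l // mulr_ge0.
rewrite (_ : (1 + c * d) * (1 + d) = 1 + c * d + (d + c * d * d)); last by ring.
rewrite (_ : 1 + (2 * 2 ^+ k - 1) * d = 1 + c * d + (d + c * d)); last by rewrite /c; ring.
by rewrite lerD2l lerD2l.
Qed.

Lemma bernoulli (d : algC) k : 0 <= d -> 1 + k%:R * d <= (1 + d) ^+ k.
Proof.
move=> d0; elim: k => [|k IH]; first by rewrite expr0 mul0r addr0.
rewrite exprSr (le_trans _ (ler_wpM2r _ IH)) ?addr_ge0 // -natr1.
rewrite (_ : (1 + k%:R * d) * (1 + d) = 1 + (k%:R + 1) * d + k%:R * d * d);
  last by ring.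
by rewrite lerDl !mulr_ge0.
Qed.

(** Turns a lower bound for [b ^ 2 - 1] into an explicit rational rate without extracting roots: the
    chord bound gives [(1 + 1/M) ^ (4 m) <= 1 + 2 ^ (4 m) / M <= 1 + 1/E <= b ^ 2]. *)
Lemma norm_ge_pow (b : algC) (E m M : nat) :
  0 <= b -> (0 < E)%N -> 1 <= (b ^+ 2 - 1) * E%:R -> (E * 2 ^ (4 * m) <= M)%N ->
  (1 + M%:R^-1) ^+ (2 * m) <= b.
Proof.
move=> b0 E0 bE EM; have M0 : (0 < M)%N.
  by apply: leq_trans EM; rewrite muln_gt0 E0 expn_gt0.
have d01 : 0 <= (M%:R^-1 : algC) <= 1 by rewrite invr_ge0 ler0n invf_le1 ?ltr0n // ler1n.
case/andP: (d01) => d0 d1.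
rewrite -(@ler_pXn2r _ 2) ?nnegrE ?exprn_ge0 ?addr_ge0 //.
rewrite -exprM (le_trans (@expr1D_le _ _ d01)) // (_ : (2 * m * 2 = 4 * m)%N); last by lia.
have b2 : E%:R^-1 <= b ^+ 2 - 1 by rewrite -div1r ler_pdivrMr ?ltr0n.
rewrite addrC -lerBrDr (le_trans _ b2) //.
rewrite ler_pdivrMr ?ltr0n // mulrC ler_pdivlMr ?ltr0n //.
apply: le_trans (_ : E%:R * 2 ^+ (4 * m) <= _); last first.
  by rewrite -natrX -natrM ler_nat.
by rewrite mulrC ler_wpM2l // gerBl.
Qed.

Section Tail.
Variables (beta : algC) (D M : nat).
Hypothesis D_gt0 : (0 < D)%N.
Hypothesis M_gt0 : (0 < M)%N.
Let a : algC := 1 + M%:R^-1.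
Hypothesis ab : a ^+ (2 * D) <= `|beta|.

Let M_gt0' : 0 < M%:R :> algC. Proof. by rewrite ltr0n. Qed.

Let a_gt1 : 1 < a. Proof. by rewrite ltrDl invr_gt0. Qed.

Let a_gt0 : 0 < a. Proof. exact: lt_trans a_gt1. Qed.

Let beta_gt0 : 0 < `|beta|.
Proof. by apply: lt_le_trans ab; rewrite exprn_gt0. Qed.

(** Half of the exponent [2 * D] absorbs the polynomial factor, because [l + 1 <= M * a ^ l] by
    Bernoulli; the other half leaves at least [a ^ l] for the decay. *)
Lemma pow_mul_geometric_le l :
  l.+1%:R ^+ D * a ^+ l <= M%:R ^+ D * `|beta| ^+ l.
Proof.
have l1 : l.+1%:R <= M%:R * a ^+ l.
  have := bernoulli l (ltW (_ : 0 < M%:R^-1 :> algC)); rewrite invr_gt0 => /(_ M_gt0').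
  move/(ler_wpM2l (ltW M_gt0')); apply: le_trans.
  rewrite mulrDr mulr1 mulrCA divff ?gt_eqF // mulr1 -natr1 addrC lerD2r ler1n.
  exact: M_gt0.
apply: (@le_trans _ _ ((M%:R * a ^+ l) ^+ D * a ^+ (D * l))).
  apply: ler_pM; rewrite ?exprn_ge0 ?(ltW a_gt0) //.
    by rewrite lerXn2r ?nnegrE ?mulr_ge0 ?exprn_ge0 ?(ltW a_gt0).
  by rewrite ler_weXn2l ?(ltW a_gt1) // leq_pmull.
rewrite exprMn -mulrA ler_wpM2l ?exprn_ge0 // -exprM -exprD.
rewrite (_ : (l * D + D * l = 2 * D * l)%N); last by lia.
by rewrite exprM lerXn2r ?nnegrE ?exprn_ge0 ?(ltW a_gt0).
Qed.

Lemma tail_le (c : nat -> algC) (A : algC) R L i :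
  0 <= A -> (forall j, `|c j| <= A * j.+1%:R ^+ D) ->
  (forall j, (R < j <= R + L)%N -> c j = 0) ->
  `|\sum_(R.+1 <= j < (R + L).+1 + i) c j * beta^-1 ^+ j| * `|beta| ^+ R
     * a ^+ L <= A * R.+1%:R ^+ D * M%:R ^+ D.+1.
Proof.
move=> A0 cA c0; set C := A * R.+1%:R ^+ D * M%:R ^+ D.
have C0 : 0 <= C by rewrite !mulr_ge0 ?exprn_ge0.
(* The induction on [i] needs the exact partial geometric sum of [a^-1 ^+ l] over [L < l <= L + i];
   its factor [M] is [1 / (a - 1)]. *)
suff tail : `|\sum_(R.+1 <= j < (R + L).+1 + i) c j * beta^-1 ^+ j|
    * `|beta| ^+ R <= C * (M%:R * (a^-1 ^+ L - a^-1 ^+ (L + i))).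
  apply: le_trans (ler_wpM2r _ tail) _; first by rewrite exprn_ge0 ?ltW.
  rewrite exprSr [leRHS]mulrA -/C -(mulrA C) -(mulrA M%:R) ler_wpM2l //.
  rewrite -[leRHS]mulr1 ler_wpM2l //.
  rewrite mulrBl -exprMn mulVf ?gt_eqF // expr1n gerBl.
  by rewrite mulr_ge0 ?exprn_ge0 ?invr_ge0 ?ltW.
elim: i => [|i IH].
  rewrite addn0 big_nat big1 => [|j jRL]; last by rewrite c0 ?mul0r.
  by rewrite normr0 mul0r addn0 subrr mulr0 mulr0.
rewrite addnS big_nat_recr /=; last by lia.
apply: le_trans (_ : (`|\sum_(R.+1 <= j < (R + L).+1 + i) c j * beta^-1 ^+ j| +
   `|c ((R + L).+1 + i)%N * beta^-1 ^+ ((R + L).+1 + i)|) * `|beta| ^+ R <= _).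
  by rewrite ler_wpM2r ?exprn_ge0 // ler_normD.
rewrite mulrDl (le_trans (lerD IH (lexx _))) //.
set l := (L + i).+1; rewrite (_ : ((R + L).+1 + i = R + l)%N); last by rewrite /l; lia.
have term : `|c (R + l)%N * beta^-1 ^+ (R + l)| * `|beta| ^+ R <= C * a^-1 ^+ l.
  rewrite normrM normrX normfV exprD -[leLHS]mulrA.
  rewrite [X in _ * X](_ : _ = `|beta|^-1 ^+ l); last first.
    by rewrite mulrAC -exprMn mulVf ?gt_eqF // expr1n mul1r.
  rewrite !exprVn ler_pdivlMr ?exprn_gt0 // mulrAC ler_pdivrMr ?exprn_gt0 //.
  apply: le_trans (ler_wpM2r _ (cA _)) _; first by rewrite exprn_ge0 ?ltW.
  apply: (@le_trans _ _ (A * (R.+1%:R ^+ D * (l.+1%:R ^+ D * a ^+ l)))).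
    rewrite -!mulrA ler_wpM2l // mulrA ler_wpM2r ?exprn_ge0 ?(ltW a_gt0) //.
    by rewrite -exprMn lerXn2r ?nnegrE // -natrM ler_nat; nia.
  rewrite /C -!mulrA ler_wpM2l // ler_wpM2l ?exprn_ge0 //.
  exact: pow_mul_geometric_le.
apply: le_trans (lerD (lexx _) term) _; rewrite -mulrDr ler_wpM2l //.
rewrite addnS -/l le_eqVlt; apply/orP; left; apply/eqP.
have -> : a^-1 ^+ (L + i) = a * a^-1 ^+ l.
  by rewrite exprS mulrA divff ?mul1r ?gt_eqF.
rewrite /a; field; rewrite ?gt_eqF //.
Qed.

End Tail.

(** * Gaps and counting *)

(** Only finite truncations are used: if the bound failed, a truncation of the relation close enough
    to 0 would contradict the tail estimate. *)
Lemma norm_digit_head_le (beta : algC) (D M h : nat) (B s : nat -> algC) R L :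
  (0 < D)%N -> (0 < M)%N -> (1 + M%:R^-1) ^+ (2 * D) <= `|beta| ->
  (0 < h)%N -> (forall k, (0 < k <= D)%N -> `|B k| <= h%:R) ->
  (forall i, `|s i| <= h%:R) ->
  (forall e, 0 < e -> exists N0, forall N, (N0 <= N)%N ->
     `|B 0 + (digit_form D B s N).[beta^-1]| < e) ->
  (forall j, (R < j <= R + L)%N -> digit_coef D B s j = 0) ->
  `|digit_head D B s beta R| * (1 + M%:R^-1) ^+ L <=
    (D * h ^ D.+1 * R.+1 ^ D * M ^ D.+1)%:R.
Proof.
move=> D0 M0 ab h0 BH sH lim g0; set a := 1 + M%:R^-1 in ab *.
have a0 : 0 < a by rewrite addr_gt0 ?invr_gt0 ?ltr0n.
have beta0 : 0 < `|beta| by apply: lt_le_trans ab; rewrite exprn_gt0.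
have bn0 : beta != 0 by rewrite -normr_gt0.
have bRaL : 0 < `|beta| ^+ R * a ^+ L by rewrite mulr_gt0 ?exprn_gt0.
rewrite real_leNgt ?realn ?realM ?realX ?normr_real ?gtr0_real //.
apply/negP; rewrite -subr_gt0 => gap.
(* The tolerance is the supposed excess divided by the scaling factor [|beta| ^ R * a ^ L]. *)
have [N0 limN0] := lim _ (divr_gt0 gap bRaL).
pose N := (N0 + (R + L).+1)%N; pose f := digit_form D B s N.
have {limN0} := limN0 N (leq_addr _ _); rewrite -/f.
pose i := (size f + N)%N.
rewrite (@horner_coef_wide _ ((R + L).+1 + i)); last by rewrite /i; lia.
rewrite -(big_mkord predT (fun j => f`_j * beta^-1 ^+ j)).
rewrite (@big_cat_nat _ _ _ R.+1) //=; last by lia.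
rewrite addrA; set tail := \sum_(R.+1 <= j < _) _.
have -> : B 0 + \sum_(0 <= j < R.+1) f`_j * beta^-1 ^+ j =
    digit_head D B s beta R * beta^-1 ^+ R.
  rewrite /digit_head mulrDl -mulrA -exprMn divff // expr1n mulr1; congr (_ + _).
  rewrite big_mkord mulr_suml; apply: eq_bigr => j _.
  rewrite digit_form_coef; last by rewrite /N; have := ltn_ord j; lia.
  rewrite -mulrA; congr (_ * _).
  have jR : (j <= R)%N by rewrite -ltnS.
  have -> : beta^-1 ^+ R = beta^-1 ^+ (R - j) * beta^-1 ^+ j.
    by rewrite -exprD subnK.
  by rewrite mulrA -exprMn divff // expr1n mul1r.
(* Coefficients of [f] of index [N] or more may differ from [digit_coef], but they obey the same
   polynomial bound; those in the gap have index below [N] and vanish. *)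
have tail_small : `|tail| * `|beta| ^+ R * a ^+ L <=
    (D * h ^ D.+1 * R.+1 ^ D * M ^ D.+1)%:R.
  rewrite !natrM !natrX; apply: tail_le => // [j|j Rj].
    by apply: digit_form_coef_le => //; rewrite ler1n.
  rewrite digit_form_coef ?g0 // /N; lia.
rewrite ltr_pdivlMr // => small; have : `|digit_head D B s beta R| * a ^+ L <=
    `|digit_head D B s beta R * beta^-1 ^+ R + tail| * (`|beta| ^+ R * a ^+ L)
    + `|tail| * `|beta| ^+ R * a ^+ L.
  rewrite -[X in _ + X]mulrA -mulrDl.
  rewrite [leRHS]mulrA ler_wpM2r ?exprn_ge0 ?(ltW a0) //.
  have E : digit_head D B s beta R =
      (digit_head D B s beta R * beta^-1 ^+ R + tail - tail) * beta ^+ R.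
    by rewrite addrK -mulrA -exprMn mulVf // expr1n mulr1.
  by rewrite {1}E normrM normrX ler_wpM2r ?exprn_ge0 // ler_normB.
move/le_lt_trans/(_ (ltr_leD small tail_small)).
by rewrite subrK ltxx.
Qed.

Section Gap.
Variables (beta : algC) (D M : nat) (B s : nat -> algC) (a h : nat) (r : seq algC).
Hypothesis betaA : beta \in Aint.
Hypothesis conjb : forall z, conjugate beta z ->
  z \in r /\ [\/ `|z| <= 1, z = beta | z = beta^*].
Hypothesis h_gt0 : (0 < h)%N.
Hypothesis sH : forall (nu : {rmorphism algC -> algC}) i, `|nu (s i)| <= h%:R.
Hypothesis BH : forall (nu : {rmorphism algC -> algC}) k,
  (k <= D)%N -> `|nu (B k)| <= h%:R.
Hypothesis sZ : forall i, in_Zadjoin beta (s i).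
Hypothesis BZ : forall k, (0 < k <= D)%N -> in_Zadjoin beta (B k).
Hypothesis B0Q : in_Qadjoin beta (B 0).
Hypothesis a_gt0 : (0 < a)%N.
Hypothesis aB0 : a%:R * B 0 \in Aint.
Hypothesis B0Z : forall n, (0 < n)%N -> ~ in_Zadjoin beta (B 0 * beta ^+ n).
Hypothesis D_gt0 : (0 < D)%N.
Hypothesis M_gt0 : (0 < M)%N.
Hypothesis ab : (1 + M%:R^-1) ^+ (2 * D) <= `|beta|.
Hypothesis lim : forall e, 0 < e -> exists N0, forall N, (N0 <= N)%N ->
  `|B 0 + (digit_form D B s N).[beta^-1]| < e.

(** A window of [M * t] zero coefficients would make the head after clearing denominators too small
    for its Liouville bound. *)
Lemma digit_coef_gap R t : (0 < R)%N ->
  (a * (D * h ^ D.+1 * R.+1 ^ D * M ^ D.+1) *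
    (a * (h + R.+1 * (D * h ^ D.+1 * R.+1 ^ D))) ^ size r < 2 ^ t)%N ->
  exists2 j, (R < j <= R + M * t)%N & digit_coef D B s j != 0.
Proof.
move=> R0; set T := (D * h ^ D.+1 * R.+1 ^ D * M ^ D.+1)%N.
set H' := (a * (h + _))%N => big.
apply: contrapT => nex.
have g0 j : (R < j <= R + M * t)%N -> digit_coef D B s j = 0.
  by move=> jR; apply/eqP; apply: contraT => nz; case: nex; exists j.
have Bid k : (0 < k <= D)%N -> `|B k| <= h%:R.
  by move=> /andP[_ kD]; exact: (BH idfun kD).
have small := norm_digit_head_le D_gt0 M_gt0 ab h_gt0 Bid (sH idfun) lim g0.
set X := a%:R * digit_head D B s beta R.
(* By Bernoulli [2 <= (1 + 1/M) ^ M], so a window of length [M * t] gains a factor [2 ^ t]. *)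
have Xt : `|X| * (2 ^ t)%:R <= (a * T)%:R.
  rewrite normrM normr_nat natrM -mulrA ler_wpM2l // (le_trans _ small) //.
  rewrite ler_wpM2l // natrX exprM lerXn2r ?nnegrE ?exprn_ge0 ?addr_ge0 ?invr_ge0 //.
  have Mn0 : M%:R != 0 :> algC by rewrite pnatr_eq0 -lt0n.
  apply: le_trans (bernoulli M _); last by rewrite invr_ge0.
  by rewrite divff // -natr1.
have H'0 : (0 < H')%N by rewrite muln_gt0 a_gt0 addn_gt0 h_gt0.
have t0 : 0 < (2 ^ t)%:R :> algC by rewrite ltr0n expn_gt0.
have X1 : `|X| <= 1.
  rewrite -(ler_pM2r t0) mul1r (le_trans Xt) // ler_nat (leq_trans _ (ltnW big)) //.
  by rewrite leq_pmulr // expn_gt0 H'0.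
have := digit_head_liouville betaA conjb h_gt0 sH BH sZ BZ B0Q a_gt0 aB0 B0Z R0 X1.
rewrite -/X -/H' -(ler_pM2r t0) mul1r mulrAC => /le_trans.
move=> /(_ _ (ler_wpM2r _ Xt)); rewrite -natrX -natrM ler_nat => /(_ (ler0n _ _)).
by rewrite leqNgt big.
Qed.

(** Each of [q] disjoint windows of length [M * t] contains the index of a nonzero coefficient;
    these indices are distinct and belong to the [D]-fold sumset. *)
Lemma count_le t N q : 
  (forall R, (0 < R < N)%N ->
  (a * (D * h ^ D.+1 * R.+1 ^ D * M ^ D.+1) *
    (a * (h + R.+1 * (D * h ^ D.+1 * R.+1 ^ D))) ^ size r < 2 ^ t)%N) ->
  (0 < t)%N -> (q * (M * t) + 1 < N)%N -> (q <= (size (support s N)).+1 ^ D)%N.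
Proof.
move=> Rt t0 qN; set L := (M * t)%N in qN.
(* The windows are shifted by 1 because the gap bound requires [R > 0]. *)
have [|F DF] := @choice nat nat (fun i j => (i < q)%N ->
  (1 + i * L < j <= 1 + i * L + L)%N /\ digit_coef D B s j != 0).
  move=> i; have [iq|] := boolP (i < q)%N; last by exists 0%N.
  have [||j jR nz] := @digit_coef_gap (1 + i * L) t; last by exists j.
    by [].
  by apply: Rt; nia.
rewrite -size_sumset -(size_iota 0 q) -(size_map F).
apply: uniq_leq_size.
  rewrite map_inj_in_uniq ?iota_uniq // => i j; rewrite !mem_iota /= !add0n.
  by move=> /DF[Fi _] /DF[Fj _] E; rewrite E in Fi; nia.
move=> j /mapP[i]; rewrite mem_iota /= add0n => iq ->.
have [Fi nz] := DF i iq; apply: digit_coef_sumset nz; nia.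
Qed.

End Gap.

(** * Explicit constants *)

(* When [m] bounds the code of the input, [step m * log2 N] bounds the gaps
   between consecutive nonzero [digit_coef]s below [N]. *)
Definition step_base (m : nat) : nat := (2 ^ (m.+1 * m.+1 * (m.+1 * m.+1)))%N.

(** [step_base m] plays the role of [M], and [step_factor m * l] that of [t] for [R < 2 ^ l]. *)
Definition step_factor (m : nat) : nat :=
  (m.+1 * (step_base m + 10 * (m.+1 * m.+1)) + 1)%N.

Definition step (m : nat) : nat := (step_base m * step_factor m)%N.

(** This is the condition on [M] in [norm_ge_pow], for the value of [E] that [norm_gt1_gap] provides
    with [h = m.+1]. *)
Lemma step_base_ge m n : (n <= m)%N ->
  ((m.+1 ^ 2 + 1) ^ (n * n) * 2 ^ (4 * m) <= step_base m)%N.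
Proof.
move=> nm; rewrite /step_base.
apply: (@leq_trans ((2 ^ (m.+1 * m.+1)) ^ (n * n) * 2 ^ (4 * m))).
  rewrite leq_mul2r; apply/orP; right; apply: leq_expr2l.
  by rewrite addn1 -mulnn ltn_expl.
rewrite -expnM -expnD leq_pexp2l // -addn1.
have : (m.+1 * m.+1 * (n * n) <= m.+1 * m.+1 * (m * m))%N by rewrite !leq_mul.
lia.
Qed.

Lemma step_factor_gt (a D l R m n : nat) :
  (a <= m)%N -> (D <= m)%N -> (n <= m)%N -> (0 < l)%N -> (R < 2 ^ l)%N ->
  (a * (D * m.+1 ^ D.+1 * R.+1 ^ D * step_base m ^ D.+1) *
    (a * (m.+1 + R.+1 * (D * m.+1 ^ D.+1 * R.+1 ^ D))) ^ n
   < 2 ^ (step_factor m * l))%N.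
Proof.
move=> am Dm nm l0 Rl; rewrite /step_factor.
move: (step_base m) => M; set h := m.+1.
have le2 x : (x <= h)%N -> (x <= 2 ^ h)%N 
  by move=> xh; apply: leq_trans xh _; apply/ltnW/ltn_expl.
have a2 : (a <= 2 ^ h)%N by apply/le2/leqW.
have D2 : (D <= 2 ^ h)%N by apply/le2/leqW.
have pow x e : (x <= 2 ^ e)%N -> forall k, (k <= h)%N -> (x ^ k <= 2 ^ (e * h))%N.
  move=> xe k kh; apply: leq_trans (leq_expr2l _ xe) _.
  by rewrite -expnM leq_exp2l // leq_mul2l kh orbT.
have hD := pow _ _ (le2 h (leqnn _)) D.+1 Dm.
have RD := pow _ _ Rl D (leqW Dm).
have MD := pow _ _ (ltnW (ltn_expl M (leqnn 2))) D.+1 Dm.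
have F1 : (a * (D * h ^ D.+1 * R.+1 ^ D * M ^ D.+1) <=
    2 ^ (h + (h + h * h + l * h + M * h)))%N.
  by rewrite !expnD !leq_mul.
(* The successor in the exponent pays for the sum of two terms. *)
have F2 : (a * (h + R.+1 * (D * h ^ D.+1 * R.+1 ^ D)) <=
    2 ^ (h + (l + (h + h * h + l * h)).+1))%N.
  rewrite expnD leq_mul // [leqRHS]expnS mul2n -addnn leq_add //.
    by apply: leq_trans (le2 h (leqnn _)) _; rewrite leq_exp2l //; lia.
  by rewrite !expnD !leq_mul.
have F3 := pow _ _ F2 n (leqW nm).
apply: leq_ltn_trans (leq_mul F1 F3) _.
(* Besides [M * h], the exponent has ten monomials, each at most [h * h * h * l]: hence the 10 in
   [step_factor], whose final 1 makes the inequality strict. *)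
rewrite -expnD ltn_exp2l //.
have : (h <= h * l)%N by rewrite leq_pmulr.
have : (h * h <= h * h * l)%N by rewrite leq_pmulr.
have : (h * h * h <= h * h * h * l)%N by rewrite leq_pmulr.
have : (M * h <= M * h * l)%N by rewrite leq_pmulr.
have : (h * l <= h * h * l)%N by rewrite leq_mul2r leq_pmulr ?orbT.
have : (h * h * l <= h * h * h * l)%N by rewrite leq_mul2r leq_pmulr ?orbT.
move: l0; clear; lia.
Qed.

Lemma sqr_le_exp2 n : (4 <= n)%N -> (n * n <= 2 ^ n)%N.
Proof.
elim: n => // n IH; rewrite leq_eqVlt => /predU1P[<-//|n4].
have : (4 * n <= n * n)%N by rewrite leq_mul.
by rewrite expnS; have := IH n4; lia.
Qed.

Lemma step_gt0 m : (0 < step m)%N.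
Proof. by rewrite muln_gt0 expn_gt0 /step_factor addn1. Qed.

(** About [N / (X * l)] windows fit below [N]. The threshold on [N] guarantees at least two, which
    excludes [lam = 0] and lets a factor 2 absorb the rounding. *)
Lemma step_count (X D N lam : nat) (l := (trunc_log 2 N).+1) :
  (0 < X)%N -> (2 ^ (12 * X) <= N)%N ->
  (forall q, (q * (X * l) + 1 < N)%N -> (q <= lam.+1 ^ D)%N) ->
  (0 < lam)%N /\ (N <= 2 * (X * l) * (2 * lam) ^ D)%N.
Proof.
move=> X0 NX count; have N0 : (0 < N)%N by apply: leq_trans NX; rewrite expn_gt0.
have vN : (2 ^ trunc_log 2 N <= N)%N by apply: trunc_logP.
have v12 : (12 * X <= trunc_log 2 N)%N by apply: trunc_log_max.
move: (trunc_log 2 N) @l vN v12 count => v /= vN v12 count.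
have v2 : (v * v <= 2 ^ v)%N by apply: sqr_le_exp2; lia.
have big : (2 * (X * v.+1) + 2 <= N)%N.
  have : (12 * X * v <= v * v)%N by rewrite leq_mul.
  have : (X <= X * v)%N by rewrite leq_pmulr; lia.
  lia.
set L := (X * v.+1)%N in count big *.
have L0 : (0 < L)%N by rewrite muln_gt0 X0.
(* The 2 comes from the strict inequality [q * L + 1 < N]. *)
pose q := ((N - 2) %/ L)%N.
have Dq := divn_eq (N - 2) L; rewrite -/q in Dq.
have rL := ltn_pmod (N - 2) L0.
have q2 : (2 <= q)%N by rewrite leq_divRL //; lia.
have qle : (q <= lam.+1 ^ D)%N by apply: count; lia.
have lam0 : (0 < lam)%N.
  by case: (posnP lam) => // lam0; move: qle; rewrite lam0 exp1n; lia.
split=> //; apply: (@leq_trans (2 * L * q)).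
  have : (2 * L <= q * L)%N by rewrite leq_mul.
  lia.
rewrite leq_mul2l; apply/orP; right; apply: leq_trans qle _.
by apply: leq_expr2l; lia.
Qed.

Lemma final_bound (R : realType) (X D N lam : nat) :
  (0 < X)%N -> (0 < D)%N -> (1 < N)%N -> (0 < lam)%N ->
  (N <= 2 * (X * (trunc_log 2 N).+1) * (2 * lam) ^ D)%N ->
  (16 * X)%N.+1%:R^-1 * (N%:R / ln N%:R) `^ (D%:R^-1) <= lam%:R :> R.
Proof.
move=> X0 D0 N1 lam0 H; set v := trunc_log 2 N in H *.
have N0 : (0 : R) < N%:R by rewrite ltr0n; lia.
have ln2 : 2^-1 <= ln 2 :> R.
  have := @le_ln1Dx R (- 2^-1); rewrite (_ : 1 - 2^-1 = 2^-1 :> R); last by lra.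
  rewrite lnV ?posrE // => /(_ _); lra.
have v1 : (1 <= v)%N by apply: trunc_log_max.
have vN : (2 ^ v <= N)%N by apply: trunc_logP => //; lia.
have lnN : v%:R * ln 2 <= ln N%:R :> R.
  by rewrite mulr_natl -lnXn // ler_ln ?posrE ?exprn_gt0 // -natrX ler_nat.
have v1R : 1 <= v%:R :> R by rewrite ler1n.
have lnv : v.+1%:R <= 4 * ln N%:R :> R.
  have : v%:R * 2^-1 <= v%:R * ln 2 :> R by rewrite ler_wpM2l.
  rewrite -[v.+1%:R]natr1; move: lnN v1R.
  by move: (v%:R : R) (v%:R * ln 2) (ln N%:R) => x y z; lra.
have lnN0 : 0 < ln N%:R :> R by rewrite ln_gt0 // ltr1n.
(* The estimate [v + 1 <= 4 ln N] turns [2 * X] into [8 * X]; as [D >= 1], this can be moved inside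
   the [D]-th power, next to [2 * lam]. *)
have base : N%:R / ln N%:R <= ((16 * X * lam)%:R : R) ^+ D.
  rewrite ler_pdivrMr //; apply: le_trans (_ : (2 * (X * v.+1) * (2 * lam) ^ D)%:R <= _).
    by rewrite ler_nat.
  rewrite (_ : (2 * (X * v.+1) * (2 * lam) ^ D = v.+1 * (2 * X * (2 * lam) ^ D))%N);
    last by lia.
  rewrite natrM; apply: le_trans (ler_wpM2r _ lnv) _; first by [].
  rewrite [leRHS]mulrC -[leLHS]mulrA [leLHS]mulrCA ler_wpM2l ?(ltW lnN0) //.
  rewrite -natrM -natrX ler_nat.
  rewrite (_ : (16 * X * lam = (8 * X) * (2 * lam))%N); last by lia.
  rewrite (expnMn (8 * X)) mulnA leq_mul2r; apply/orP; right.
  by rewrite mulnA -[leqLHS]expn1 leq_pexp2l //; lia.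
rewrite mulrC ler_pdivrMr ?ltr0n //.
apply: (@le_trans _ _ (16 * X * lam)%:R); last first.
  by rewrite -natrM ler_nat; lia.
have -> : (16 * X * lam)%:R = ((16 * X * lam)%:R ^+ D) `^ D%:R^-1 :> R.
  by rewrite -powR_mulrn // -powRrM divff ?pnatr_eq0 -?lt0n // powRr1.
by apply: ge0_ler_powR; rewrite ?nnegrE ?invr_ge0 ?exprn_ge0 ?divr_ge0 ?(ltW lnN0).
Qed.

(** * Bounds read off the codes of the input *)

Lemma encodes_bounded (c : algnum_code) (x : algC) m :
  encodes c x -> (pickle c <= m)%N ->
  exists p : {poly int}, [/\ p != 0, root (map_poly intr p) x, (size p <= m)%N &
    forall i, (`|(p`_i)%R| <= m)%N].
Proof.
case: c => p [[u v] w] [p0 px _ _] cm; exists p.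
have pm : (pickle p <= m)%N by apply: leq_trans cm; have [] := pickle_pair_ge p (u, v, w).
split=> // [|i]; first exact: leq_trans (size_poly_le_pickle p) pm.
exact: leq_trans (coef_le_pickle p i) pm.
Qed.

Lemma encodes_aut_le (c : algnum_code) (x : algC) m
    (nu : {rmorphism algC -> algC}) :
  encodes c x -> (pickle c <= m)%N -> `|nu x| <= m.+1%:R.
Proof.
move=> cx /(encodes_bounded cx)[p [p0 px _ pm]].
exact: norm_root_le p0 pm (root_intr_aut nu px).
Qed.

Lemma encodes_conjugates (c : algnum_code) (x : algC) m :
  encodes c x -> (pickle c <= m)%N ->
  exists2 r : seq algC, (size r <= m)%N & forall z, conjugate x z -> z \in r.
Proof.
move=> cx /(encodes_bounded cx)[p [p0 px szp _]].
have [r Dr] := closed_field_poly_normal (map_poly intr p : {poly algC}).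
have inj : injective (intr : int -> algC) by apply: intr_inj.
have lc0 : lead_coef (map_poly intr p : {poly algC}) != 0.
  by rewrite lead_coef_map_inj // intr_eq0 lead_coef_eq0.
exists r.
  apply: leq_trans szp; rewrite -(size_map_inj_poly inj) // Dr size_scale //.
  by rewrite size_prod_XsubC.
move=> z /conjugate_aut[nu <-]; have := root_intr_aut nu px.
by rewrite Dr rootZ // root_prod_XsubC.
Qed.

(** The absolute value of the leading coefficient of the encoded polynomial serves as
    denominator. *)
Lemma encodes_Aint_mul (c : algnum_code) (x : algC) m :
  encodes c x -> (pickle c <= m)%N ->
  exists a : nat, [/\ (0 < a)%N, (a <= m)%N & a%:R * x \in Aint].
Proof.
move=> cx /(encodes_bounded cx)[p [p0 px _ pm]].
exists `|lead_coef p|%N; split; [by rewrite absz_gt0 lead_coef_eq0 | exact: pm |].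
rewrite pmulrn abszEsign rmorphM rmorph_sign -mulrA rpredMsign.
exact: lead_coef_mul_Aint.
Qed.

Lemma Forall2_size (T U : Type) (P : T -> U -> Prop) s t :
  List.Forall2 P s t -> size s = size t.
Proof. by elim=> //= x y s' t' _ _ ->. Qed.

Lemma Forall2_mem (T U : eqType) (P : T -> U -> Prop) s t y :
  List.Forall2 P s t -> y \in t -> exists2 x, x \in s & P x y.
Proof.
elim=> // x z s' t' Pxz _ IH; rewrite inE => /predU1P[->|/IH[w ws Pw]].
  by exists x; rewrite ?mem_head.
by exists w; rewrite // inE ws orbT.
Qed.

(** * The relation as a limit of truncations *)

Lemma cvg_sum_pow (D : nat) (B : nat -> algC) (u : nat -> algC^o) (eta : algC^o) :
  u @ \oo --> eta ->
  ((fun N => \sum_(k < D) B k * u N ^+ k) : nat -> algC^o) @ \oo -->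
    (\sum_(k < D) B k * eta ^+ k : algC^o).
Proof.
move=> ueta; elim: D => [|D IH].
  under eq_fun do rewrite big_ord0.
  by rewrite big_ord0; apply: cvg_cst.
under eq_fun do rewrite big_ord_recr /=.
rewrite big_ord_recr /=; apply: cvgD => //; apply: cvgM; first exact: cvg_cst.
elim: (D) => [|k IHk]; first by under eq_fun do rewrite expr0; apply: cvg_cst.
under eq_fun do rewrite exprS.
by rewrite exprS; apply: cvgM.
Qed.

(** The value at [beta^-1], with [B 0] added, is the relation with [eta] replaced by a partial sum
    of its expansion, so continuity applies. *)
Lemma digit_form_cvg0 (beta eta : algC) (D : nat) (B s : nat -> algC) :
  (series (fun n : nat => s n / beta ^+ n) : nat -> algC^o) @ \oo
    --> (eta : algC^o) ->
  \sum_(k < D.+1) B k * eta ^+ k = 0 ->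
  forall e, 0 < e -> exists N0, forall N, (N0 <= N)%N ->
    `|B 0 + (digit_form D B s N).[beta^-1]| < e.
Proof.
move=> ueta; have lim := @cvg_sum_pow D.+1 B _ _ ueta; move=> eta0 e e0; rewrite eta0 in lim.
have /cvgrPdist_lt/(_ e e0)[N0 _ HN] := lim.
exists N0 => N N0N; have := HN N N0N; rewrite /= sub0r normrN.
rewrite big_ord_recl expr0 mulr1 horner_digit_form; congr (is_true (`|_ + _| < e)).
rewrite big_add1 big_mkord; apply: eq_bigr => k _ /=.
congr (_ * _ ^+ _); rewrite /series /= big_mkord.
by apply: eq_bigr => i _; rewrite exprVn.
Qed.

Lemma size_support (s : nat -> algC) N : size (support s N) = lambda s N.
Proof.
rewrite /lambda cardE -(size_map val); congr size.
by rewrite /support -val_enum_ord filter_map enumT.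
Qed.

(** * Choice of the constants and assembly of the estimates *)

Theorem theorem2p4 (R : realType) :
  exists C7 C8 : input_code -> rat,
  [/\ computable C7, computable C8 &
  forall (c : input_code) (beta eta : algC) (D : nat) (S : seq algC)
         (B : D.+1.-tuple algC) (s : nat -> algC),
  encodes_input c beta eta S B ->
  quasi_Pisot beta \/ quasi_Salem beta ->
  relative_degree beta eta D ->
  (forall x, x \in S -> in_Zadjoin beta x) ->
  0 \in S ->
  (~ {subset S <= Num.int} ->
     beta \isn't Num.real /\
     exists alpha : algC,
       [/\ imaginary_quadratic alpha, alpha \in Aint, in_Qadjoin beta alpha &
           forall x, x \in S -> in_integer_ring alpha x]) ->
  (forall n, s n \in S) ->
  (series (fun n : nat => s n / beta ^+ n) : nat -> algC^o) @ \oo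
    --> (eta : algC^o) ->
  in_Qadjoin beta B`_0 ->
  (forall k : nat, (1 <= k <= D)%N -> in_Zadjoin beta B`_k) ->
  B`_D != 0 ->
  \sum_(k < D.+1) B`_k * eta ^+ k = 0 ->
  (forall n : nat, (0 < n)%N -> ~ in_Zadjoin beta (B`_0 * beta ^+ n)) ->
  [/\ 0 < C7 c, 0 < C8 c &
  forall N : nat, (C8 c <= N%:R)%R ->
    ratr (C7 c) * (N%:R / ln N%:R) `^ (D%:R^-1) <= (lambda s N)%:R :> R]].
Proof.
pose X (v : seq nat) := step (nth 0%N v 0).
have recX : recursive X.
  have recS : recursive (fun v => (nth 0 v 0).+1)%N.
    under eq_fun do rewrite -addn1.
    by apply: recursive_add; [exact: recursive_proj | exact: recursive_const].
  have recSS := recursive_mul recS recS.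
  have recM := recursive_exp2 (recursive_mul recSS recSS).
  apply: recursive_mul => //; apply: recursive_add; last exact: recursive_const.
  apply: recursive_mul => //; apply: recursive_add => //.
  by apply: recursive_mul => //; exact: recursive_const.
exists (fun c => (16 * X [:: pickle c]).+1%:R^-1),
  (fun c => (2 ^ (12 * X [:: pickle c]))%:R).
split.
- apply: (@computable_natV _ (fun v => 16 * X v)%N).
  by apply: recursive_mul => //; exact: recursive_const.
- apply: (@computable_nat _ (fun v => 2 ^ (12 * X v))%N).
  by apply/recursive_exp2/recursive_mul => //; exact: recursive_const.
move=> c beta eta D S B s enc betaPS _ SZ _ _ sS lim B0Q BZ BD eta0 B0Z.
rewrite -[X [:: pickle c]]/(step (pickle c)); set m := pickle c.
split; [by rewrite invr_gt0 ltr0n | by rewrite ltr0n expn_gt0 | move=> N].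
rewrite ler_nat => NX.
have {enc} [[cbeta [encb cbm]] encS encB szB] : [/\
    exists cb, encodes cb beta /\ (pickle cb <= m)%N,
    forall x, x \in S -> exists cx, encodes cx x /\ (pickle cx <= m)%N,
    forall k, (k <= D)%N -> exists cx, encodes cx B`_k /\ (pickle cx <= m)%N &
    (D.+1 <= m)%N].
  clear NX; rewrite {}/m; case: c enc => [[[cb ce] cS] cB] [encb _ encS encB].
  have [le1 leB] := pickle_pair_ge (cb, ce, cS) cB.
  have [le2 leS] := pickle_pair_ge (cb, ce) cS.
  have [le3 _] := pickle_pair_ge cb ce.
  split.
  - by exists cb; split=> //; exact: leq_trans le3 (leq_trans le2 le1).
  - move=> x xS; have [cx cxS encx] := Forall2_mem encS xS; exists cx; split=> //.
    exact: leq_trans (pickle_seq_ge cxS) (leq_trans leS le1).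
  - move=> k kD; have kB : B`_k \in (B : seq algC) by rewrite mem_nth ?size_tuple.
    have [cx cxB encx] := Forall2_mem encB kB; exists cx; split=> //.
    exact: leq_trans (pickle_seq_ge cxB) leB.
  - rewrite -[D.+1](size_tuple B) -(Forall2_size encB).
    exact: leq_trans (size_le_pickle cB) leB.
(* For [D = 0] the relation would read [B_0 = 0], against [B_D != 0]. *)
have D0 : (0 < D)%N.
  rewrite lt0n; apply: contraNneq BD => D0; rewrite -[X in _ == X]eta0 big_ord_recl.
  rewrite expr0 mulr1 big1 => [|i _]; last by have := ltn_ord i; lia.
  by rewrite addr0; apply/eqP; congr (nth _ _ _).
have [betaA beta1 betaC] : [/\ beta \in Aint, 1 < `|beta| &
    forall z, conjugate beta z -> [\/ `|z| <= 1, z = beta | z = beta^*]].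
  have conj3 : (forall z, conjugate beta z -> z != beta ->
      z != beta^* -> `|z| <= 1) -> forall z, conjugate beta z ->
      [\/ `|z| <= 1, z = beta | z = beta^*].
    move=> H z bz; have [->|zb] := eqVneq z beta; first by apply: Or32.
    have [->|zb'] := eqVneq z beta^*; first by apply: Or33.
    by apply/Or31/H.
  case: betaPS => [[bA b1 bC]|[bA b1 bC _]]; split=> //; apply: conj3 => //.
  by move=> z bz zb zb'; apply/ltW/bC.
have [r szr conjr] := encodes_conjugates encb cbm.
have [a [a0 am aB0]] := let: ex_intro _ (conj e le) := encB 0%N isT in
  encodes_Aint_mul e le.
have sH (nu : {rmorphism algC -> algC}) i : `|nu (s i)| <= m.+1%:R.
  by have [cx [e le]] := encS _ (sS i); apply: encodes_aut_le e le.
have BH (nu : {rmorphism algC -> algC}) k : (k <= D)%N -> `|nu B`_k| <= m.+1%:R.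
  by move=> /encB[cx [e le]]; apply: encodes_aut_le e le.
have M0 : (0 < step_base m)%N by rewrite expn_gt0.
have ab : (1 + (step_base m)%:R^-1) ^+ (2 * D) <= `|beta|.
  have base : 1 <= (`|beta| ^+ 2 - 1) * ((m.+1 ^ 2 + 1) ^ (size r * size r))%:R.
    rewrite natrX; apply: norm_gt1_gap => // z bz; split; last exact: conjr.
    by have [nu <-] := conjugate_aut bz; apply: encodes_aut_le encb cbm.
  (* The code also bounds the length [D.+1] of the list of coefficients, so [D] can be replaced by
     [m] in the exponent. *)
  apply: le_trans (_ : (1 + (step_base m)%:R^-1) ^+ (2 * m) <= _).
    by rewrite ler_weXn2l ?lerDl ?invr_ge0 //; lia.
  by apply: norm_ge_pow base (step_base_ge szr); rewrite // expn_gt0 addn1.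
have conjb z : conjugate beta z ->
    z \in r /\ [\/ `|z| <= 1, z = beta | z = beta^*].
  by move=> bz; split; [exact: conjr | exact: betaC].
have lam_gap := count_le betaA conjb (ltn0Sn m) sH BH (fun i => SZ _ (sS i)) BZ
  B0Q a0 aB0 B0Z D0 M0 ab (digit_form_cvg0 lim eta0).
have [lam0 Nle] : (0 < lambda s N)%N /\
    (N <= 2 * (step m * (trunc_log 2 N).+1) * (2 * lambda s N) ^ D)%N.
  apply: step_count => //; first exact: step_gt0.
  move=> q qN; rewrite -size_support.
  (* Every index below [N] is less than [2 ^ (trunc_log 2 N).+1], so a single [t] suits all
     windows. *)
  apply: (lam_gap (step_factor m * (trunc_log 2 N).+1)%N).
  - move=> n /andP[n0 nN]; apply: step_factor_gt => //; first exact: ltnW.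
    by apply: ltn_trans nN _; apply: trunc_log_ltn.
  - by rewrite muln_gt0 /step_factor addn1.
  - by rewrite (mulnA (step_base m)).
rewrite fmorphV /= rmorph_nat; apply: final_bound => //; first exact: step_gt0.
apply: leq_trans NX; rewrite -[1%N]/(2 ^ 0)%N ltn_exp2l // muln_gt0 step_gt0.
by [].
Qed.
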